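(* For every $\epsilon\in(0,1)$ there exist constants $C_\epsilon>0$ and $N_\epsilon$ such that the following holds. Let $n\ge N_\epsilon$, let $\mu$ be any product probability measure on $\{0,1\}^n$, and let $f\colon\{0,1\}^n\to\{0,1\}$. Then there exist a set $S\subseteq[n]$ with $|S|\le C_\epsilon\,\frac{n\log\log n}{\log n}$ and a value $b\in\{0,1\}$ such that $I^b_S(f)\ge 1-\epsilon$. (Equivalently: no Boolean function on $(\{0,1\}^n,\mu)$ is $\epsilon$-resilient against coalitions of size $\omega_\epsilon\!\left(\frac{n\log\log n}{\log n}\right)$.)
   Context: A product probability measure $\mu$ on $\{0,1\}^n$ is one under which the coordinates $x_1,\dots,x_n$ are independent (with arbitrary marginals $\Pr[x_i=1]=p_i\in[0,1]$). For $x\in\{0,1\}^n$ and $S\subseteq[n]$, let $B_S(x)=\{y\in\{0,1\}^n: y_j=x_j \text{ for all } j\notin S\}$. For a function $f$ on $\{0,1\}^n$ and a value $b$, the influence of the coalition $S$ towards $b$ is $I^b_S(f)=\Pr_{x\sim\mu}[\,b\in f(B_S(x))\,]$, i.e. the probability that $x$ can be modified on the coordinates in $S$ so that $f$ takes the value $b$. A function is $\epsilon$-resilient against coalitions of size $\ell$ if no set $S$ with $|S|\le \ell$ and value $b$ satisfy $I^b_S(f)\ge 1-\epsilon$. *)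

(* Defs.v *)
From mathcomp Require Import all_boot all_order all_algebra.
From mathcomp Require Import reals exp.

Set Implicit Arguments.
Unset Strict Implicit.
Unset Printing Implicit Defensive.

Import Order.TTheory GRing.Theory Num.Theory.
Local Open Scope ring_scope.

Definition cube (n : nat) : finType := {ffun 'I_n -> bool}.

Section Influence.
Variables (R : realType) (n : nat).
Implicit Types (mu : cube n -> R) (f : cube n -> bool) (S : {set 'I_n}).

(* A measure on the finite set [cube n] is given by its point masses. *)
Definition Pr mu (E : {set cube n}) : R := \sum_(x in E) mu x.

Definition is_probability mu : Prop :=
  (forall x, 0 <= mu x) /\ Pr mu [set: cube n] = 1.

(* Mutual independence of the n coordinates; independence of a subfamily
   is the case [A i = setT] for the indices [i] outside of it. *)
Definition independent_coordinates mu : Prop :=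
  forall A : 'I_n -> {set bool},
    Pr mu [set x : cube n | [forall i, x i \in A i]] =
    \prod_(i < n) Pr mu [set x : cube n | x i \in A i].

Definition product_probability mu : Prop :=
  is_probability mu /\ independent_coordinates mu.

Definition coalition_box S (x : cube n) : {set cube n} :=
  [set y : cube n | [forall j, (j \notin S) ==> (y j == x j)]].

Definition influence mu f S (b : bool) : R :=
  Pr mu [set x : cube n | b \in f @: coalition_box S x].

End Influence.

(* Main.v *)
(* Call a coordinate very biased when one of its two values has probability
   less than [delta = 1 / ln n], and let [V] be the set of such coordinates.

   Very biased coordinates.  Freeze the coordinates outside [V] and draw
   independent samples X_1, ..., X_m.  Let D_j be the set of coordinates of [V]
   where X_j takes its unlikely value, and S_i the union of the D_j, j <> i.
   The boxes of X_i over S_i and of X_j over S_j always meet, so the samples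
   whose box is monochromatic share one colour.  The samples other than X_i thus
   exclude a colour for themselves, and if X_i has a monochromatic box of that
   excluded colour then it is the only sample with a monochromatic box.  These m
   events are disjoint, so on average one of them has probability at most 1/m.
   Hence some S of size O(m delta n) leaves, for almost every assignment outside
   [V], a value that can be forced almost surely.

   Remaining coordinates.  Let h be the indicator that value 1 can be forced in
   this way.  If h is rarely true then S forces value 0.  Otherwise a second
   coalition drives h to 1, adding at each step a coordinate whose L_2 influence
   is of order ln n / (n ln (1/delta)).  It exists by the argument of Falik and
   Samorodnitsky: the two-point logarithmic Sobolev constant is
   O(ln (1/delta)), and it is applied to the martingale differences of h.
   This takes O(n ln (1/delta) / ln n) = O(n ln ln n / ln n) steps. *)

Require Import Defs.
From mathcomp Require Import all_boot all_order all_algebra.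
From mathcomp Require Import reals sequences exp.
From mathcomp Require Import ring lra.

Import Order.TTheory GRing.Theory Num.Theory.
Local Open Scope ring_scope.

Set Implicit Arguments.
Unset Strict Implicit.
Unset Printing Implicit Defensive.

(** * Expectation, coordinate averages and deviations under product weights *)

Section ProductExpectation.
Variables (R : realFieldType) (I T : finType).
Implicit Types (P : I -> T -> R) (x y : {ffun I -> T}) (g h : {ffun I -> T} -> R).

Definition is_marginals P :=
  (forall i t, 0 <= P i t) /\ (forall i, \sum_t P i t = 1).

Definition weight P x : R := \prod_i P i (x i).

Definition expect P g : R := \sum_x weight P x * g x.

Definition update x i t : {ffun I -> T} := [ffun j => if j == i then t else x j].

Definition average P i g x : R := \sum_t P i t * g (update x i t).

Definition average_seq P s g := foldr (average P) g s.

Definition deviation P i g x : R := g x - average P i g x.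

Lemma update_same x i t : update x i t i = t.
Proof. by rewrite ffunE eqxx. Qed.

Lemma updateK x i t u : update (update x i t) i u = update x i u.
Proof. by apply/ffunP => j; rewrite !ffunE; case: eqP. Qed.

Lemma update_id x i : update x i (x i) = x.
Proof. by apply/ffunP => j; rewrite ffunE; case: eqP => // ->. Qed.

Lemma updateC x i j t u : i != j ->
  update (update x i t) j u = update (update x j u) i t.
Proof.
move=> ij; apply/ffunP => k; rewrite !ffunE.
by case: eqP => // ->; rewrite eq_sym (negbTE ij).
Qed.

Section Fixed.
Variable P : I -> T -> R.
Hypothesis Pm : is_marginals P.

Lemma weight_ge0 x : 0 <= weight P x.
Proof. by apply: prodr_ge0 => i _; apply: Pm.1. Qed.

Lemma sum_weight : \sum_x weight P x = 1.
Proof.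
rewrite /weight -(bigA_distr_bigA (fun i t => P i t)) /=.
by apply: big1 => i _; apply: Pm.2.
Qed.

Lemma eq_expect g h : g =1 h -> expect P g = expect P h.
Proof. by move=> e; apply: eq_bigr => x _; rewrite e. Qed.

Lemma expect_cst c : expect P (fun=> c) = c.
Proof. by rewrite /expect -big_distrl /= sum_weight mul1r. Qed.

Lemma expectD g h : expect P (fun x => g x + h x) = expect P g + expect P h.
Proof. by rewrite /expect -big_split; apply: eq_bigr => x _; rewrite mulrDr. Qed.

Lemma expectZ c g : expect P (fun x => c * g x) = c * expect P g.
Proof. by rewrite /expect mulr_sumr; apply: eq_bigr => x _; rewrite mulrCA. Qed.

Lemma expectB g h : expect P (fun x => g x - h x) = expect P g - expect P h.
Proof. by rewrite /expect -sumrB; apply: eq_bigr => x _; rewrite mulrBr. Qed.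

Lemma expect_sum (J : Type) (r : seq J) (F : J -> {ffun I -> T} -> R) :
  expect P (fun x => \sum_(j <- r) F j x) = \sum_(j <- r) expect P (F j).
Proof.
by rewrite /expect exchange_big; apply: eq_bigr => x _; rewrite mulr_sumr.
Qed.

Lemma ler_expect g h : (forall x, g x <= h x) -> expect P g <= expect P h.
Proof. by move=> gh; apply: ler_sum => x _; rewrite ler_wpM2l ?weight_ge0. Qed.

Lemma expect_ge0 g : (forall x, 0 <= g x) -> 0 <= expect P g.
Proof. by move=> g0; rewrite -(expect_cst 0); apply: ler_expect. Qed.

Lemma expect_le_exists g c : expect P g <= c -> exists x, g x <= c.
Proof.
move=> gc; apply/existsP; apply: contraTT gc; rewrite negb_exists -ltNge.
move=> /forallP lt_c; rewrite -[ltLHS](expect_cst c) ltNge.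
apply/negP => le_gc.
have := sum_weight; rewrite big1; first by move/esym/eqP; rewrite oner_eq0.
move=> x _; apply/eqP; rewrite eq_le weight_ge0 andbT.
have D y : 0 <= weight P y * (g y - c).
  by rewrite mulr_ge0 ?weight_ge0 // subr_ge0 ltW // ltNge lt_c.
have S0 : \sum_y weight P y * (g y - c) <= 0.
  by rewrite -[X in X <= _]/(expect P (fun y => g y - c)) expectB subr_le0.
have {}S0 : weight P x * (g x - c) <= 0.
  apply: le_trans S0; rewrite (bigD1 x) //= lerDl.
  by apply: sumr_ge0 => y _.
by rewrite -(pmulr_lle0 _ (_ : 0 < g x - c)) // subr_gt0 ltNge lt_c.
Qed.

(** Multiplied out rather than divided, since marginals may vanish. *)
Lemma weight_update x i t :
  weight P (update x i t) * P i (x i) = weight P x * P i t.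
Proof.
rewrite /weight (bigD1 i) //= [in RHS](bigD1 i) //= update_same.
rewrite (eq_bigr (fun j => P j (x j))); last first.
  by move=> j ij; rewrite ffunE (negbTE ij).
by rewrite mulrC mulrA mulrAC.
Qed.

(** Swapping the coordinate with its fresh value is an involution on pairs that preserves the joint
    weight. *)
Lemma expect_average i g : expect P (average P i g) = expect P g.
Proof.
pose flip (u : {ffun I -> T} * T) := (update u.1 i u.2, u.1 i).
have flipK : involutive flip.
  by case=> x t; rewrite /flip /= update_same updateK update_id.
rewrite /expect /average.
under eq_bigr do rewrite mulr_sumr.
rewrite pair_big /= (reindex_inj (inv_inj flipK)) /=.
rewrite -(pair_big xpredT xpredT (fun x t =>
  weight P (update x i t) * (P i (x i) * g (update (update x i t) i (x i))))) /=.
apply: eq_bigr => x _.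
under eq_bigr do rewrite mulrA weight_update updateK update_id mulrAC.
by rewrite -mulr_sumr Pm.2 mulr1.
Qed.

Lemma eq_average i g h : g =1 h -> average P i g =1 average P i h.
Proof. by move=> e x; apply: eq_bigr => t _; rewrite e. Qed.

Lemma average_update i g x t : average P i g (update x i t) = average P i g x.
Proof. by apply: eq_bigr => u _; rewrite updateK. Qed.

Lemma averageM i g h x :
  average P i (fun z => average P i g z * h z) x = average P i g x * average P i h x.
Proof.
rewrite [in RHS]/average mulr_sumr; apply: eq_bigr => t _.
by rewrite average_update mulrCA.
Qed.

Lemma average_idem i g : average P i (average P i g) =1 average P i g.
Proof.
move=> x; rewrite [LHS]/average; under eq_bigr do rewrite average_update.
by rewrite -big_distrl /= Pm.2 mul1r.
Qed.

Lemma averageC i j g : average P i (average P j g) =1 average P j (average P i g).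
Proof.
move=> x; case: (eqVneq i j) => [-> //|ij]; rewrite /average.
under eq_bigr do rewrite mulr_sumr.
under [in RHS]eq_bigr do rewrite mulr_sumr.
rewrite exchange_big; apply: eq_bigr => t _; apply: eq_bigr => u _.
by rewrite mulrCA updateC.
Qed.

Lemma averageB i g h x :
  average P i (fun z => g z - h z) x = average P i g x - average P i h x.
Proof. by rewrite /average -sumrB; apply: eq_bigr => t _; rewrite mulrBr. Qed.

Lemma ler_average i g h x :
  (forall z, g z <= h z) -> average P i g x <= average P i h x.
Proof. by move=> gh; apply: ler_sum => t _; rewrite ler_wpM2l ?Pm.1. Qed.

Lemma average_ge0 i g x : (forall z, 0 <= g z) -> 0 <= average P i g x.
Proof. by move=> g0; apply: sumr_ge0 => t _; rewrite mulr_ge0 ?Pm.1. Qed.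

Lemma average_norm i g x : `|average P i g x| <= average P i (fun z => `|g z|) x.
Proof.
apply: le_trans (ler_norm_sum _ _ _) _; apply: ler_sum => t _.
by rewrite normrM ger0_norm ?Pm.1.
Qed.

(** Pythagoras: [average P i] is an orthogonal projection in L_2. *)
Lemma expect_sqr_deviation i g :
  expect P (fun x => deviation P i g x ^+ 2) =
  expect P (fun x => g x ^+ 2) - expect P (fun x => average P i g x ^+ 2).
Proof.
have -> : expect P (fun x => average P i g x ^+ 2) =
    expect P (fun x => average P i g x * g x).
  rewrite -[RHS](expect_average i); apply: eq_expect => x.
  by rewrite averageM expr2.
rewrite -expectB -[LHS](expect_average i) -[RHS](expect_average i).
apply: eq_expect => x; rewrite averageB averageM.
rewrite (@eq_average i _ (fun z => g z ^+ 2 - average P i g z * (2 * g z - average P i g z))).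
  rewrite averageB averageM averageB average_idem.
  have -> : average P i (fun z => 2 * g z) x = 2 * average P i g x.
    by rewrite /average mulr_sumr; apply: eq_bigr => t _; rewrite mulrCA.
  by congr (_ - _); congr (_ * _); ring.
by move=> z; rewrite /deviation; ring.
Qed.

Lemma deviation_average i j g :
  deviation P i (average P j g) =1 average P j (deviation P i g).
Proof. by move=> x; rewrite /deviation averageB averageC. Qed.

Lemma deviationC i j g :
  deviation P i (deviation P j g) =1 deviation P j (deviation P i g).
Proof.
move=> x; rewrite /deviation !averageB averageC.
by rewrite !opprB addrACA [in RHS]addrACA; congr (_ + _); rewrite addrC.
Qed.

Lemma eq_deviation i g h : g =1 h -> deviation P i g =1 deviation P i h.
Proof. by move=> e x; rewrite /deviation e (eq_average i e). Qed.

Lemma expect_average_seq s g : expect P (average_seq P s g) = expect P g.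
Proof. by elim: s => //= i s <-; apply: expect_average. Qed.

Lemma average_seq_ge0 s g x : (forall z, 0 <= g z) -> 0 <= average_seq P s g x.
Proof. by move=> g0; elim: s x => //= i s IH x; apply: average_ge0. Qed.

Lemma deviation_average_seq i s g :
  deviation P i (average_seq P s g) =1 average_seq P s (deviation P i g).
Proof.
elim: s => //= j s IH x; rewrite deviation_average.
exact: eq_average.
Qed.

Lemma average_seq_norm s g x :
  `|average_seq P s g x| <= average_seq P s (fun z => `|g z|) x.
Proof.
elim: s x => //= i s IH x.
by apply: le_trans (average_norm _ _ _) _; apply: ler_average.
Qed.

Lemma average_seq_local s g x y :
  (forall i, i \notin s -> x i = y i) -> average_seq P s g x = average_seq P s g y.
Proof.
elim: s x y => [x y xy|i s IH x y xy] /=.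
  by congr g; apply/ffunP => i; apply: xy.
apply: eq_bigr => t _; congr (_ * _); apply: IH => j js; rewrite !ffunE.
by case: eqP => // /eqP ji; apply: xy; rewrite inE negb_or ji.
Qed.

Lemma average_seq_enum g x : average_seq P (enum I) g x = expect P g.
Proof.
rewrite -(expect_average_seq (enum I)) -[LHS]expect_cst; apply: eq_expect => y.
by apply: average_seq_local => i; rewrite mem_enum.
Qed.

End Fixed.

End ProductExpectation.

(** * Entropy inequalities for logarithms and on two points *)

Section TwoPoint.
Variable R : realType.
Implicit Types x y p q delta a b m : R.

Lemma normr_sqr x : `|x| ^+ 2 = x ^+ 2.
Proof. exact/real_normK/num_real. Qed.

Lemma ln_le_sub1 x : 0 < x -> ln x <= x - 1.
Proof.
move=> x0; have := @le_ln1Dx R (x - 1).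
by rewrite [1 + _]addrC subrK; apply; lra.
Qed.

Lemma ln_ge_sub_inv x : 0 < x -> 1 - x^-1 <= ln x.
Proof.
move=> x0; have := @ln_le_sub1 x^-1; rewrite invr_gt0 lnV // => /(_ x0).
lra.
Qed.

(** Nonnegativity of relative entropy for unnormalised densities, with [g] absolutely continuous
    with respect to [h]. *)
Lemma gibbs (T : finType) (p g h : T -> R) :
    (forall t, 0 < p t) -> (forall t, 0 <= g t) -> (forall t, 0 <= h t) ->
    (forall t, h t = 0 -> g t = 0) ->
  \sum_t p t * (g t * (ln (h t) - ln (\sum_u p u * h u))) <=
  \sum_t p t * (g t * (ln (g t) - ln (\sum_u p u * g u))).
Proof.
move=> p0 g0 h0 hg; set hb := \sum_u p u * h u; set gb := \sum_u p u * g u.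
have le_gb t : p t * g t <= gb.
  rewrite /gb (bigD1 t) //= lerDl; apply: sumr_ge0 => u _.
  by rewrite mulr_ge0 // ltW.
have le_hb t : p t * h t <= hb.
  rewrite /hb (bigD1 t) //= lerDl; apply: sumr_ge0 => u _.
  by rewrite mulr_ge0 // ltW.
have hb0 : 0 <= hb by apply: sumr_ge0 => t _; rewrite mulr_ge0 // ltW.
have gb0 : 0 <= gb by apply: sumr_ge0 => t _; rewrite mulr_ge0 // ltW.
rewrite -subr_le0 -sumrB.
(* The factor [gb / hb] rescales [h] to the mean of [g], so after [ln x <= x - 1] the two sums
   cancel. *)
apply: (@le_trans _ _ (\sum_t p t * (h t * (gb / hb) - g t))).
  apply: ler_sum => t _; rewrite -mulrBr ler_pM2l // -mulrBr.
  have [-> |gt0] := eqVneq (g t) 0.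
    by rewrite mul0r subr0 mulr_ge0 // divr_ge0.
  have {}gt0 : 0 < g t by rewrite lt_neqAle eq_sym gt0 g0.
  have ht0 : 0 < h t.
    by rewrite lt_neqAle eq_sym h0 andbT; apply: contra_neq (hg t) (lt0r_neq0 gt0).
  have gbt : 0 < gb by apply: lt_le_trans (le_gb t); rewrite mulr_gt0.
  have hbt : 0 < hb by apply: lt_le_trans (le_hb t); rewrite mulr_gt0.
  have -> : h t * (gb / hb) - g t = g t * (h t / g t * (gb / hb) - 1).
    by field; rewrite !lt0r_neq0.
  rewrite ler_pM2l //.
  apply: le_trans (ln_le_sub1 _); last by rewrite !mulr_gt0 ?invr_gt0.
  rewrite lnM ?posrE ?divr_gt0 // !ln_div ?posrE //.
  lra.
have -> : \sum_t p t * (h t * (gb / hb) - g t) =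
    (\sum_t p t * h t) * (gb / hb) - \sum_t p t * g t.
  by rewrite mulr_suml -sumrB; apply: eq_bigr => t _; ring.
rewrite -/hb -/gb.
have [hbz|hbn] := eqVneq hb 0; last by rewrite mulrCA divff // mulr1 subrr.
by rewrite hbz mul0r sub0r oppr_le0.
Qed.

Lemma xlogx_le x m : 0 <= x -> 0 < m -> x * (ln x - ln m) <= x * (x / m - 1).
Proof.
rewrite le_eqVlt => /predU1P[<-|x0] m0; first by rewrite !mul0r.
rewrite ler_pM2l // -ln_div ?posrE //; apply: ln_le_sub1.
by rewrite divr_gt0.
Qed.

(** When [b] dominates, [a ^+ 2 <= m] makes the first term nonpositive, the second is at most
    [p * b ^+ 2 * (- ln p)], and [(a - b) ^+ 2] is comparable to [b ^+ 2]. *)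
Lemma two_point_log_sobolev_far p q delta a b m :
    0 < delta -> delta <= p -> delta <= q -> p + q = 1 ->
    16 * a ^+ 2 < b ^+ 2 -> m = q * a ^+ 2 + p * b ^+ 2 ->
  q * (a ^+ 2 * (ln (a ^+ 2) - ln m)) + p * (b ^+ 2 * (ln (b ^+ 2) - ln m)) <=
  34 * (1 - ln delta) * (p * q * (a - b) ^+ 2).
Proof.
move=> d0 dp dq pq1 ab mE.
have p0 : 0 < p by lra.
have q0 : 0 < q by lra.
have a2 : 0 <= a ^+ 2 by apply: sqr_ge0.
have b2 : 0 < b ^+ 2 by lra.
have pb : p * b ^+ 2 <= m by rewrite mE lerDr mulr_ge0 // ltW.
have m0 : 0 < m by apply: lt_le_trans pb; rewrite mulr_gt0.
have lnd : ln delta <= 0 by apply: ln_le0; lra.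
have A0 : q * (a ^+ 2 * (ln (a ^+ 2) - ln m)) <= 0.
  rewrite pmulr_rle0 //; apply: le_trans (xlogx_le a2 m0) _.
  rewrite mulr_ge0_le0 // subr_le0 ler_pdivrMr // mul1r mE.
  have : q * a ^+ 2 + p * a ^+ 2 <= q * a ^+ 2 + p * b ^+ 2.
    by rewrite lerD2l ler_pM2l //; lra.
  by rewrite -mulrDl addrC addrC [q + p]addrC pq1 mul1r.
have ab2 : 9 / 16 * b ^+ 2 <= (a - b) ^+ 2.
  have : `|4 * a| <= `|b|.
    rewrite -ler_sqr ?nnegrE // !normr_sqr; lra.
  have : `|b| - `|a| <= `|a - b| by rewrite distrC lerB_dist.
  rewrite normrM ger0_norm // => h1 h2.
  have h3 : 3 / 4 * `|b| <= `|a - b| by lra.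
  have : (3 / 4 * `|b|) ^+ 2 <= `|a - b| ^+ 2.
    by rewrite ler_sqr ?nnegrE // mulr_ge0 //; lra.
  by rewrite exprMn !normr_sqr; lra.
have B0 : ln (b ^+ 2) - ln m <= - ln p.
  have pb0 : 0 < p * b ^+ 2 by apply: mulr_gt0.
  have : ln (p * b ^+ 2) <= ln m by rewrite ler_ln ?posrE.
  rewrite lnM ?posrE //.
  lra.
(* The factor [q] comes for free when [q] is at least 1/2; otherwise [- ln p <= q / p <= 2 * q]. *)
have lnp : - ln p <= 34 * (1 - ln delta) * q * (9 / 16).
  have le_d : ln delta <= ln p by rewrite ler_ln ?posrE.
  have le_i : - ln p <= q / p.
    have qE : q = 1 - p by lra.
    have -> : q / p = p^-1 - 1 by rewrite qE; field; rewrite lt0r_neq0.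
    by have := ln_ge_sub_inv p0; lra.
  have [q2|q2] := lerP (1 / 2) q.
    have : (1 - ln delta) * (1 / 2) <= (1 - ln delta) * q.
      by apply: ler_wpM2l => //; lra.
    lra.
  have : q / p <= 2 * q.
    rewrite ler_pdivrMr // mulrAC -mulrA mulrC -subr_ge0.
    have -> : p * q * 2 - q = q * (2 * p - 1) by ring.
    by rewrite mulr_ge0 //; lra.
  have : 0 <= q * (- ln delta) by rewrite mulr_ge0; lra.
  lra.
have : p * (b ^+ 2 * (ln (b ^+ 2) - ln m)) <= p * (b ^+ 2 * (- ln p)).
  by rewrite ler_pM2l // ler_pM2l.
have : p * (b ^+ 2 * (- ln p)) <= p * (b ^+ 2 * (34 * (1 - ln delta) * q * (9 / 16))).
  by rewrite ler_pM2l // ler_pM2l.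
have : 34 * (1 - ln delta) * (p * q) * (9 / 16 * b ^+ 2) <=
    34 * (1 - ln delta) * (p * q) * (a - b) ^+ 2.
  by apply: ler_wpM2l => //; rewrite !mulr_ge0 //; lra.
lra.
Qed.

(** For comparable values, [ln x <= x - 1] bounds the entropy by the variance of the squares over
    [m], that is [p * q * (a - b) ^+ 2 * (a + b) ^+ 2 / m]. The constant 34 arises from
    [(a + b) ^+ 2 <= 2 * (a ^+ 2 + b ^+ 2)] and [a ^+ 2 + b ^+ 2 <= 17 * m]. *)
Lemma two_point_log_sobolev p q delta a b m :
    0 < delta -> delta <= p -> delta <= q -> p + q = 1 ->
    m = q * a ^+ 2 + p * b ^+ 2 ->
  q * (a ^+ 2 * (ln (a ^+ 2) - ln m)) + p * (b ^+ 2 * (ln (b ^+ 2) - ln m)) <=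
  34 * (1 - ln delta) * (p * q * (a - b) ^+ 2).
Proof.
move=> d0 dp dq pq1 mE.
have [ab|ab] := ltP (16 * a ^+ 2) (b ^+ 2); first exact: two_point_log_sobolev_far.
have [ba|ba] := ltP (16 * b ^+ 2) (a ^+ 2).
  have := two_point_log_sobolev_far d0 dq dp _ ba.
  rewrite addrC [p * b ^+ 2 + _]addrC -mE => /(_ _ pq1 erefl) h; rewrite addrC.
  by apply: le_trans h _; rewrite [q * p]mulrC -[(b - a) ^+ 2]sqrrN opprB.
have p0 : 0 < p by lra.
have q0 : 0 < q by lra.
have a2 : 0 <= a ^+ 2 by apply: sqr_ge0.
have b2 : 0 <= b ^+ 2 by apply: sqr_ge0.
have lnd : ln delta <= 0 by apply: ln_le0; lra.
have ab0 : 0 <= p * q * (a - b) ^+ 2 by apply: mulr_ge0; [apply: mulr_ge0; lra|exact: sqr_ge0].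
have K0 : 0 <= (- ln delta) * (p * q * (a - b) ^+ 2) by rewrite mulr_ge0 //; lra.
have mge : a ^+ 2 + b ^+ 2 <= 17 * m.
  have qE : q = 1 - p by lra.
  rewrite mE qE; have : 0 <= p * (17 * b ^+ 2 - (a ^+ 2 + b ^+ 2)) by rewrite mulr_ge0; lra.
  have : 0 <= q * (17 * a ^+ 2 - (a ^+ 2 + b ^+ 2)) by rewrite mulr_ge0; lra.
  rewrite qE; lra.
have m0 : 0 <= m by rewrite mE addr_ge0 // mulr_ge0 // ltW.
have [mz|mn] := eqVneq m 0.
  have az : a ^+ 2 = 0 by lra.
  have bz : b ^+ 2 = 0 by lra.
  rewrite az bz !mul0r !mulr0 addr0; lra.
have {mn}m0 : 0 < m by rewrite lt_neqAle eq_sym mn.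
apply: (@le_trans _ _ (q * (a ^+ 2 * (a ^+ 2 / m - 1)) + p * (b ^+ 2 * (b ^+ 2 / m - 1)))).
  by apply: lerD; rewrite ler_pM2l //; apply: xlogx_le.
have -> : q * (a ^+ 2 * (a ^+ 2 / m - 1)) + p * (b ^+ 2 * (b ^+ 2 / m - 1)) =
          p * q * (a - b) ^+ 2 * ((a + b) ^+ 2 / m).
  have qE : q = 1 - p by lra.
  rewrite mE qE; field; rewrite -qE -mE; exact: lt0r_neq0.
apply: (@le_trans _ _ (p * q * (a - b) ^+ 2 * 34)); last by lra.
apply: ler_wpM2l => //; rewrite ler_pdivrMr //.
have : 0 <= (a - b) ^+ 2 by apply: sqr_ge0.
have : (a + b) ^+ 2 + (a - b) ^+ 2 = 2 * (a ^+ 2 + b ^+ 2) by ring.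
lra.
Qed.

(** This is [ln y <= y - 1] at [y = lambda * Num.sqrt s / |x|], with [lambda] left free for later
    tuning. *)
Lemma sqr_ln_sqr_ge (lambda s x : R) : 0 < lambda -> 0 < s ->
  2 * (1 + ln lambda) * x ^+ 2 - 2 * lambda * Num.sqrt s * `|x| <=
  x ^+ 2 * (ln (x ^+ 2) - ln s).
Proof.
move=> l0 s0; have [->|x0] := eqVneq x 0.
  by rewrite normr0 expr0n /= !mulr0 mul0r subrr.
have ax : 0 < `|x| by rewrite normr_gt0.
have r0 : 0 < Num.sqrt s by rewrite sqrtr_gt0.
have -> : ln s = 2 * ln (Num.sqrt s) by rewrite mulr_natl -lnXn // sqr_sqrtr // ltW.
rewrite -(normr_sqr x).
have -> : ln (`|x| ^+ 2) = 2 * ln `|x| by rewrite lnXn // mulr_natl.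
have := @ln_le_sub1 (lambda * Num.sqrt s / `|x|).
rewrite !mulr_gt0 ?invr_gt0 // => /(_ isT).
rewrite ln_div ?posrE ?mulr_gt0 // lnM ?posrE // => h.
have : `|x| ^+ 2 * (ln lambda + ln (Num.sqrt s) - ln `|x|) <=
       `|x| ^+ 2 * (lambda * Num.sqrt s / `|x| - 1) by rewrite ler_wpM2l ?sqr_ge0.
have -> : `|x| ^+ 2 * (lambda * Num.sqrt s / `|x| - 1) = lambda * Num.sqrt s * `|x| - `|x| ^+ 2.
  by field; rewrite lt0r_neq0.
lra.
Qed.

End TwoPoint.

(** * Subadditivity of entropy and a lower bound on the entropy of a square *)

Section Entropy.
Variables (R : realType) (I T : finType) (P : I -> T -> R).
Hypotheses (Pm : is_marginals P) (P_gt0 : forall i t, 0 < P i t).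
Implicit Types g h d : {ffun I -> T} -> R.

Lemma average_eq0 i g x :
  (forall z, 0 <= g z) -> average P i g x = 0 -> g x = 0.
Proof.
move=> g0 /psumr_eq0P gx0; have /eqP := gx0 (fun t _ => mulr_ge0 (Pm.1 i t) (g0 _)) (x i) isT.
by rewrite update_id mulf_eq0 gt_eqF ?P_gt0 //= => /eqP.
Qed.

Lemma average_seq_eq0 s g x :
  (forall z, 0 <= g z) -> average_seq P s g x = 0 -> g x = 0.
Proof.
move=> g0; elim: s x => //= i s IH x /average_eq0 h.
by apply: IH; apply: h => z; apply: average_seq_ge0.
Qed.

(** Chain rule: the entropy telescopes along the list, and on each fibre [gibbs] replaces the
    partially averaged function by [g] itself. *)
Lemma entropy_average_seq s g : (forall z, 0 <= g z) ->
  expect P (fun x => g x * (ln (g x) - ln (average_seq P s g x))) <=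
  \sum_(i <- s) expect P (fun x => g x * (ln (g x) - ln (average P i g x))).
Proof.
move=> g0; elim: s => [|i s IH] /=.
  rewrite big_nil (@eq_expect _ _ _ _ _ (fun=> 0)) ?expect_cst // => x.
  by rewrite subrr mulr0.
rewrite big_cons; set h := average_seq P s g.
rewrite (@eq_expect _ _ _ _ _ (fun x => g x * (ln (h x) - ln (average P i h x)) +
  g x * (ln (g x) - ln (h x)))); last by move=> x; ring.
rewrite expectD; apply: lerD => //.
rewrite -(expect_average Pm i) -[leRHS](expect_average Pm i).
apply: (ler_expect Pm) => x.
have inner f : average P i (fun z => g z * (ln (f z) - ln (average P i f z))) x =
    \sum_t P i t * (g (update x i t) *
      (ln (f (update x i t)) - ln (\sum_u P i u * f (update x i u)))).
  by apply: eq_bigr => t _; rewrite average_update.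
rewrite !inner.
have := @gibbs R T (P i) (fun t => g (update x i t)) (fun t => h (update x i t)).
apply => // [t|t]; first exact: average_seq_ge0.
exact: average_seq_eq0.
Qed.

Lemma entropy_subadditive g : (forall z, 0 <= g z) ->
  expect P (fun x => g x * (ln (g x) - ln (expect P g))) <=
  \sum_i expect P (fun x => g x * (ln (g x) - ln (average P i g x))).
Proof.
move=> g0; have := entropy_average_seq (enum I) g0.
rewrite big_enum /=; apply: le_trans; rewrite le_eqVlt; apply/orP; left.
by apply/eqP/eq_expect => x; rewrite average_seq_enum.
Qed.

(** A function whose L_1 norm is small next to its L_2 norm has a square of large entropy. The
    pointwise bound is integrated and the cross term absorbed by completing a square. *)
Lemma entropy_sqr_ge (lambda : R) d : 0 < lambda ->
  (1 + 2 * ln lambda) * expect P (fun x => d x ^+ 2) -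
    lambda ^+ 2 * expect P (fun x => `|d x|) ^+ 2 <=
  expect P (fun x => d x ^+ 2 * (ln (d x ^+ 2) - ln (expect P (fun y => d y ^+ 2)))).
Proof.
move=> l0; set s := expect P (fun y => d y ^+ 2); set r := expect P (fun x => `|d x|).
have s0 : 0 <= s by apply: (expect_ge0 Pm) => x; apply: sqr_ge0.
have [sz|sn] := eqVneq s 0.
  rewrite sz mulr0 sub0r.
  rewrite [leRHS](_ : _ = 0); first by rewrite oppr_le0 -exprMn sqr_ge0.
  apply: big1 => x _; rewrite mulrA.
  have /psumr_eq0P -> : \sum_x weight P x * d x ^+ 2 = 0 by [].
  - by rewrite mul0r.
  - by move=> y _; rewrite mulr_ge0 ?sqr_ge0 // weight_ge0.
  - by [].
have {sn}s_gt0 : 0 < s by rewrite lt_neqAle eq_sym sn.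
apply: (@le_trans _ _ (expect P (fun x => 2 * (1 + ln lambda) * d x ^+ 2 -
   2 * lambda * Num.sqrt s * `|d x|))); last first.
  by apply: (ler_expect Pm) => x; apply: sqr_ln_sqr_ge.
rewrite expectB !expectZ -/s -/r.
have : 0 <= (Num.sqrt s - lambda * r) ^+ 2 by apply: sqr_ge0.
rewrite sqrrB sqr_sqrtr // exprMn -mulr_natl; lra.
Qed.

End Entropy.

(** * Logarithmic Sobolev inequality on the biased cube *)

Section LogSobolev.
Variables (R : realType) (I : finType) (P : I -> bool -> R) (delta : R).
Hypotheses (Pm : is_marginals P) (delta0 : 0 < delta).
Hypothesis delta_le : forall i t, delta <= P i t.
Implicit Types g h d : {ffun I -> bool} -> R.

Let P_gt0 i t : 0 < P i t.
Proof. exact: lt_le_trans (delta_le i t). Qed.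

Lemma marginal_sum i : P i true + P i false = 1.
Proof. by rewrite -(Pm.2 i) big_bool. Qed.

Lemma average_bool i g x : average P i g x =
  P i true * g (update x i true) + P i false * g (update x i false).
Proof. by rewrite /average big_bool. Qed.

Lemma deviation_bool i g x t : deviation P i g (update x i t) =
  P i (~~ t) * (g (update x i t) - g (update x i (~~ t))).
Proof.
rewrite /deviation average_update average_bool.
have := marginal_sum i; case: t => /= h.
  by rewrite -[X in X - _]mul1r -h; ring.
by rewrite -[X in X - _]mul1r -h; ring.
Qed.

Lemma average_sqr_deviation i g x :
  average P i (fun z => deviation P i g z ^+ 2) x =
  P i true * P i false * (g (update x i false) - g (update x i true)) ^+ 2.
Proof.
rewrite average_bool !deviation_bool /= -[RHS]mul1r -(marginal_sum i); ring.
Qed.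

(** Subadditivity of entropy tensorises the two-point inequality. *)
Lemma log_sobolev d :
  expect P (fun x => d x ^+ 2 * (ln (d x ^+ 2) - ln (expect P (fun y => d y ^+ 2)))) <=
  34 * (1 - ln delta) * \sum_i expect P (fun x => deviation P i d x ^+ 2).
Proof.
have := entropy_subadditive Pm P_gt0 (fun x => sqr_ge0 (d x)).
move=> /le_trans; apply; rewrite mulr_sumr; apply: ler_sum => i _.
rewrite -(expect_average Pm i) -[X in _ <= _ * X](expect_average Pm i) -expectZ.
apply: (ler_expect Pm) => x; rewrite average_sqr_deviation average_bool.
rewrite !average_update addrC.
apply: two_point_log_sobolev => //; first exact: marginal_sum.
by rewrite average_bool addrC.
Qed.

(* The martingale differences [deviation i (average_seq s F)] of Falik and
   Samorodnitsky: their energies add up to that of [F], so the logarithmic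
   Sobolev inequality can be applied to each of them separately. *)
Lemma martingale_log_sobolev (lambda : R) s F : 0 < lambda ->
  (1 + 2 * ln lambda) *
    (expect P (fun x => F x ^+ 2) - expect P (fun x => average_seq P s F x ^+ 2)) <=
  34 * (1 - ln delta) *
    \sum_j (expect P (fun x => deviation P j F x ^+ 2) -
            expect P (fun x => average_seq P s (deviation P j F) x ^+ 2)) +
  lambda ^+ 2 * \sum_(k <- s) expect P (fun x => `|deviation P k F x|) ^+ 2.
Proof.
move=> l0; elim: s => [|k s IH] /=.
  rewrite big_nil subrr !mulr0 addr0 big1 ?mulr0 // => j _.
  by rewrite subrr.
rewrite big_cons; set H := average_seq P s F in IH *.
pose d := deviation P k H.
have dE : expect P (fun x => d x ^+ 2) =
    expect P (fun x => H x ^+ 2) - expect P (fun x => average P k H x ^+ 2).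
  exact: expect_sqr_deviation.
have d1 : expect P (fun x => `|d x|) <= expect P (fun x => `|deviation P k F x|).
  rewrite -[leRHS](expect_average_seq Pm s); apply: (ler_expect Pm) => x.
  by rewrite /d deviation_average_seq; apply: average_seq_norm.
have d2 : expect P (fun x => `|d x|) ^+ 2 <= expect P (fun x => `|deviation P k F x|) ^+ 2.
  by rewrite ler_sqr ?nnegrE //; apply: (expect_ge0 Pm).
have dj j : expect P (fun x => deviation P j d x ^+ 2) =
    expect P (fun x => average_seq P s (deviation P j F) x ^+ 2) -
    expect P (fun x => average P k (average_seq P s (deviation P j F)) x ^+ 2).
  rewrite -(expect_sqr_deviation Pm); apply: eq_expect => x.
  rewrite /d deviationC; congr (_ ^+ 2); apply: eq_deviation => y.
  exact: deviation_average_seq.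
have sum_dj : \sum_j (expect P (fun x => deviation P j F x ^+ 2) -
    expect P (fun x => average P k (average_seq P s (deviation P j F)) x ^+ 2)) =
  \sum_j (expect P (fun x => deviation P j F x ^+ 2) -
    expect P (fun x => average_seq P s (deviation P j F) x ^+ 2)) +
  \sum_j expect P (fun x => deviation P j d x ^+ 2).
  by rewrite -big_split; apply: eq_bigr => j _; rewrite dj /= addrA subrK.
have lower := entropy_sqr_ge Pm d l0.
have upper := log_sobolev d.
have : lambda ^+ 2 * expect P (fun x => `|d x|) ^+ 2 <=
       lambda ^+ 2 * expect P (fun x => `|deviation P k F x|) ^+ 2.
  by rewrite ler_wpM2l ?sqr_ge0.
move: lower upper IH; rewrite sum_dj dE.
lra.
Qed.

(** Averaging over every coordinate leaves the constant [expect P F], so the energy difference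
    becomes the variance; the subtracted nonnegative energies are dropped. *)
Lemma variance_log_sobolev (lambda : R) F : 0 < lambda ->
  (1 + 2 * ln lambda) * (expect P (fun x => F x ^+ 2) - expect P F ^+ 2) <=
  34 * (1 - ln delta) * \sum_j expect P (fun x => deviation P j F x ^+ 2) +
  lambda ^+ 2 * \sum_j expect P (fun x => `|deviation P j F x|) ^+ 2.
Proof.
move=> l0; have := martingale_log_sobolev (enum I) F l0.
rewrite big_enum /= (@eq_expect _ _ _ _ (fun x => average_seq P (enum I) F x ^+ 2)
  (fun=> expect P F ^+ 2)); last by move=> x; rewrite average_seq_enum.
rewrite expect_cst // => /le_trans; apply; rewrite lerD2r.
(* A single coordinate already forces [delta <= 1]; without coordinates the sums are empty. *)
have [d1|d1] := lerP delta 1; last first.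
  have [i|noI] := pickP I; last by rewrite !big_pred0.
  by have := marginal_sum i; have := delta_le i true; have := P_gt0 i false; lra.
apply: ler_wpM2l; first by have := ln_le0 d1; lra.
apply: ler_sum => j _; rewrite gerBl; apply: (expect_ge0 Pm) => x.
exact: sqr_ge0.
Qed.

End LogSobolev.

(** * Existence of an influential coordinate *)

Section InfluentialCoordinate.
Variables (R : realType) (I : finType) (P : I -> bool -> R) (delta : R).
Hypotheses (Pm : is_marginals P) (delta0 : 0 < delta).
Hypothesis delta_le : forall i t, delta <= P i t.
Implicit Types f : {ffun I -> bool} -> bool.

Definition prob f : R := expect P (fun x => (f x)%:R).

(** The L_2 influence: [P i true * P i false] times the probability that [i] is pivotal. *)
Definition influence_at i f : R :=
  expect P (fun x => deviation P i (fun z => (f z)%:R) x ^+ 2).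

Definition force i f : {ffun I -> bool} -> bool :=
  fun x => f (update x i true) || f (update x i false).

Lemma prob_le1 f : prob f <= 1.
Proof.
by rewrite -[leRHS](expect_cst Pm); apply: (ler_expect Pm) => x; rewrite lern1 leq_b1.
Qed.

(** Boolean differences have modulus 0 or 1, so the L_1 norm is linear in the influence and its
    square, as used in the variance bound, is quadratic. *)
Lemma expect_norm_deviation i f :
  expect P (fun x => `|deviation P i (fun z => (f z)%:R) x|) = 2 * influence_at i f.
Proof.
rewrite /influence_at -[LHS](expect_average Pm i).
rewrite -[X in _ = _ * X](expect_average Pm i) -expectZ.
apply: eq_expect => x; rewrite average_sqr_deviation // average_bool !deviation_bool //=.
rewrite !normrM !(ger0_norm (Pm.1 _ _)).
by case: (f _); case: (f _); rewrite /= ?mulr1n ?mulr0n ?subrr ?subr0 ?sub0r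
  ?normr0 ?normrN ?normr1; ring.
Qed.

(** On a pivotal fibre forcing raises the mean from one of the two masses to 1, a gain of the other
    mass, which is at least their product. *)
Lemma prob_force i f : prob f + influence_at i f <= prob (force i f).
Proof.
rewrite /prob /influence_at -(expect_average Pm i (fun x => (f x)%:R)).
rewrite -(expect_average Pm i (fun x => _ ^+ 2)) -expectD.
apply: (ler_expect Pm) => x; rewrite average_sqr_deviation // average_bool /force.
have := marginal_sum Pm i; have := Pm.1 i true; have := Pm.1 i false.
set p := P i true; set q := P i false => q0 p0 pq1.
have : 0 <= p * p by apply: mulr_ge0.
have : 0 <= q * q by apply: mulr_ge0.
have -> : q = 1 - p by lra.
by case: (f _); case: (f _) => /=; lra.
Qed.

Lemma exists_influential f : (0 < #|I|)%N ->
  exists i, prob f * (1 - prob f) * ln #|I|%:R / (4 * #|I|%:R * (34 * (1 - ln delta)))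
    <= influence_at i f.
Proof.
move=> I0; set nu := prob f; set V := nu * (1 - nu); set n : R := #|I|%:R.
set K := 34 * (1 - ln delta); set theta := _ / _.
have /card_gt0P[i0 _] := I0.
have nu0 : 0 <= nu by apply: (expect_ge0 Pm) => x.
have V0 : 0 <= V by rewrite mulr_ge0 // subr_ge0 prob_le1.
have V1 : V <= 1 by have := sqr_ge0 nu; have := prob_le1 f; rewrite -/nu /V; lra.
have n1 : 1 <= n by rewrite ler1n.
have L0 : 0 <= ln n by apply: ln_ge0.
have d1 : delta <= 1.
  by have := marginal_sum Pm i0; have := delta_le i0 true; have := Pm.1 i0 false; lra.
have K34 : 34 <= K by have := ln_le0 d1; rewrite /K; lra.
have n0 : 0 < n by lra.
have theta0 : 0 <= theta
  by rewrite divr_ge0 //; apply: mulr_ge0 => //; [apply: mulr_ge0|]; lra.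
apply/existsP; apply: contraT; rewrite negb_exists => /forallP small.
have lt_theta i : influence_at i f < theta by rewrite ltNge small.
have [Vz|Vn] := eqVneq V 0.
  have := lt_theta i0; rewrite ltNge /theta Vz !mul0r.
  by rewrite (expect_ge0 Pm) // => x; apply: sqr_ge0.
have {Vn}Vpos : 0 < V by rewrite lt_neqAle eq_sym Vn.
(* The parameter [lambda] is [l], the fourth root of [n]: then [2 * ln l = ln n / 2], while the L_1
   terms only pay [l ^+ 2 = t]. *)
set t := Num.sqrt n.
have t1 : 1 <= t by rewrite -sqrtr1 ler_wsqrtr.
have t0 : 0 < t by lra.
have nE : n = t ^+ 2 by rewrite sqr_sqrtr // ltW.
have LE : ln n = 2 * ln t by rewrite nE lnXn // mulr_natl.
have Lt : ln n <= 2 * t by rewrite LE; have := ln_le_sub1 t0; lra.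
set l := Num.sqrt t.
have l0 : 0 < l by rewrite sqrtr_gt0.
have tE : t = l ^+ 2 by rewrite sqr_sqrtr // ltW.
have lE : 2 * ln l = ln n / 2 by rewrite LE tE lnXn // -mulr_natl; lra.
have := variance_log_sobolev Pm delta0 delta_le (fun x => (f x)%:R) l0.
rewrite -tE lE -/K -/(prob f) -/nu.
rewrite (@eq_expect _ _ _ _ (fun x => (f x)%:R ^+ 2) (fun x => (f x)%:R)); last first.
  by move=> x; case: (f x); rewrite ?expr1n ?expr0n.
rewrite -/(prob f) -/nu.
have -> : nu - nu ^+ 2 = V by rewrite /V; ring.
have S1 : \sum_j expect P (fun x => deviation P j (fun z => (f z)%:R) x ^+ 2) <= n * theta.
  rewrite /n mulr_natl -sumr_const; apply: ler_sum => j _; exact/ltW/lt_theta.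
have S2 : \sum_j expect P (fun x => `|deviation P j (fun z => (f z)%:R) x|) ^+ 2
    <= n * (4 * theta ^+ 2).
  rewrite /n mulr_natl -sumr_const; apply: ler_sum => j _.
  rewrite expect_norm_deviation exprMn -natrX ler_wpM2l // ler_sqr ?nnegrE //.
    exact/ltW/lt_theta.
  by apply: (expect_ge0 Pm) => x; apply: sqr_ge0.
have K0 : 0 < K by lra.
(* The 4 in [theta] keeps each right-hand term at most [V * ln n / 4], and the left side is
   [(1 + ln n / 2) * V], a contradiction. *)
have E1 : K * (n * theta) = V * ln n / 4.
  by rewrite /theta; field; rewrite !lt0r_neq0.
have E2 : t * (n * (4 * theta ^+ 2)) = V * ln n / 4 * (V * (ln n / (t * K ^+ 2))).
  by rewrite /theta nE; field; rewrite !lt0r_neq0.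
have Q : V * (ln n / (t * K ^+ 2)) <= 1.
  apply: mulr_ile1 => //; first by rewrite divr_ge0 // mulr_ge0 ?sqr_ge0 // ltW.
  have tK0 : 0 < t * K ^+ 2 by apply: mulr_gt0 => //; apply: exprn_gt0.
  rewrite ler_pdivrMr // mul1r.
  apply: le_trans Lt _; rewrite mulrC ler_pM2l // expr2.
  by apply: le_trans (_ : 2 <= 34 * 34) _; [lra|apply: ler_pM; lra].
have VL : 0 <= V * ln n / 4 by rewrite divr_ge0 // mulr_ge0.
have E2' : t * (n * (4 * theta ^+ 2)) <= V * ln n / 4 by rewrite E2 ler_piMr.
move=> main; suff : False by [].
have := ler_wpM2l (ltW K0) S1; have := ler_wpM2l (ltW t0) S2; rewrite E1.
lra.
Qed.

End InfluentialCoordinate.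

(** * Growing a coalition one coordinate at a time *)

Section Coalitions.
Variables (n : nat).
Implicit Types (x y : cube n) (f : cube n -> bool) (S : {set 'I_n}).

Definition boost S f : cube n -> bool :=
  fun x => [exists y in coalition_box S x, f y].

Lemma coalition_boxP S x y :
  reflect (forall j, j \notin S -> y j = x j) (y \in coalition_box S x).
Proof.
rewrite inE; apply: (iffP forallP) => [h j jS|h j].
  by apply/eqP; have := h j; rewrite jS.
by apply/implyP => jS; apply/eqP/h.
Qed.

Lemma coalition_box_refl S x : x \in coalition_box S x.
Proof. exact/coalition_boxP. Qed.

Lemma boost0 f : f =1 boost set0 f.
Proof.
move=> x; apply/idP/existsP => [fx|[y /andP[/coalition_boxP xy]]].
  by exists x; rewrite coalition_box_refl.
by have -> : y = x by apply/ffunP => j; apply: xy; rewrite inE.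
Qed.

Lemma boost_force i S f x : force i (boost S f) x -> boost (i |: S) f x.
Proof.
have aux t : boost S f (update x i t) -> boost (i |: S) f x.
  move=> /existsP[y /andP[/coalition_boxP xy fy]]; apply/existsP; exists y.
  rewrite fy andbT; apply/coalition_boxP => j; rewrite in_setU1 negb_or => /andP[ji jS].
  by rewrite xy // ffunE (negbTE ji).
by case/orP; apply: aux.
Qed.

Variables (R : realType) (P : 'I_n -> bool -> R) (delta : R).
Hypotheses (Pm : is_marginals P) (delta0 : 0 < delta).
Hypothesis delta_le : forall i t, delta <= P i t.

(** Greedy growth: as long as the boosted probability lies between [eta] and [1 - eta], adding an
    influential coordinate gains at least [gamma]. *)
Lemma boost_growth f (eta gamma : R) t :
    (forall g, eta <= prob P g -> prob P g < 1 - eta ->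
      exists i, gamma <= influence_at P i g) ->
    eta <= prob P f -> 0 <= gamma ->
  exists S, (#|S| <= t)%N /\
    (1 - eta <= prob P (boost S f) \/ eta + gamma * t%:R <= prob P (boost S f)).
Proof.
move=> infl fge gamma0; elim: t => [|t [S [St IH]]].
  exists set0; rewrite cards0; split=> //; right.
  by rewrite mulr0 addr0 /prob
    -(eq_expect P (fun x => congr1 (fun b : bool => b%:R) (boost0 f x))).
have [big|small] := lerP (1 - eta) (prob P (boost S f)).
  by exists S; split; [exact: leqW|left].
case: IH => [big|IH]; first by move: small; rewrite ltNge big.
have [|i gi] := infl _ _ small.
  by apply: le_trans IH; rewrite lerDl mulr_ge0.
exists (i |: S); split; first by rewrite cardsU1 (leq_add (leq_b1 _) St).
right; apply: (@le_trans _ _ (prob P (force i (boost S f)))).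
  apply: le_trans (prob_force Pm i _); rewrite -natr1 mulrDr mulr1 addrA.
  exact: lerD.
apply: (ler_expect Pm) => x; rewrite ler_nat.
by have := @boost_force i S f x; case: (force _ _ _) => // ->.
Qed.

Lemma boosting_coalition f (eta : R) : (1 < n)%N -> 0 < eta -> eta < 1 ->
    eta <= prob P f ->
  exists S, 1 - eta <= prob P (boost S f) /\
    #|S|%:R <= 4 * n%:R * (34 * (1 - ln delta)) / (eta * (1 - eta) * ln n%:R) + 1.
Proof.
move=> n1 eta0 eta1 fge; set K := 34 * _; set L : R := ln n%:R.
have L0 : 0 < L by apply: ln_gt0; rewrite ltr1n.
have d1 : delta <= 1.
  pose i0 := Ordinal n1.
  by have := marginal_sum Pm i0; have := delta_le i0 true; have := Pm.1 i0 false; lra.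
have K0 : 0 < K by have := ln_le0 d1; rewrite /K; lra.
have n0 : 0 < n%:R :> R by rewrite ltr0n; apply: leq_trans n1.
have c0 : 0 < 4 * n%:R * K by apply: mulr_gt0 => //; apply: mulr_gt0.
(* Between [eta] and [1 - eta] the variance of a Boolean function is at least [eta * (1 - eta)]. *)
set gamma := eta * (1 - eta) * L / (4 * n%:R * K).
have gamma0 : 0 < gamma.
  by apply: divr_gt0 => //; apply: mulr_gt0 => //; apply: mulr_gt0; lra.
have gammaV : gamma^-1 = 4 * n%:R * K / (eta * (1 - eta) * L) by rewrite invf_div.
have infl g : eta <= prob P g -> prob P g < 1 - eta ->
    exists i, gamma <= influence_at P i g.
  move=> ge lt; have [|i gi] := exists_influential Pm delta0 delta_le g.
    by rewrite card_ord; apply: leq_trans n1.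
  exists i; apply: le_trans gi; rewrite card_ord -/L -/K.
  rewrite ler_pM2r ?invr_gt0 // ler_pM2r //.
  have : 0 <= (prob P g - eta) * (1 - eta - prob P g) by apply: mulr_ge0; lra.
  lra.
(* With [gamma * t%:R > 1] the second alternative of [boost_growth] would exceed probability 1;
   rounding up costs the final [+ 1]. *)
set t := (Num.truncn gamma^-1).+1.
have [S [St big]] := boost_growth t infl fge (ltW gamma0).
have tgt : gamma^-1 < t%:R by apply: truncnS_gt.
exists S; split; last first.
  rewrite -gammaV; apply: (@le_trans _ _ t%:R); first by rewrite ler_nat.
  by rewrite -natr1 lerD2r truncn_le // invr_ge0 ltW.
case: big => // big; exfalso.
have : 1 < gamma * t%:R by rewrite mulrC -ltr_pdivrMr // div1r.
have := prob_le1 Pm (boost S f); lra.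
Qed.

End Coalitions.

(** * Splicing two independent points along a set of coordinates *)

Section Mixing.
Variables (R : realFieldType) (I T : finType) (P Q : I -> T -> R) (V : {set I}).
Implicit Types (x y : {ffun I -> T}) (g : {ffun I -> T} -> R).

Definition mix x y : {ffun I -> T} := [ffun k => if k \in V then x k else y k].

Lemma expect_exchange (J U : finType) (P' : J -> U -> R)
    (h : {ffun I -> T} -> {ffun J -> U} -> R) :
  expect P (fun x => expect P' (h x)) = expect P' (fun u => expect P (fun x => h x u)).
Proof.
rewrite /expect; under eq_bigr do rewrite mulr_sumr.
rewrite exchange_big; apply: eq_bigr => y _; rewrite mulr_sumr.
by apply: eq_bigr => x _; rewrite mulrCA.
Qed.

Lemma expect_coordinate i (g : T -> R) : is_marginals P ->
  expect P (fun x => g (x i)) = \sum_t P i t * g t.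
Proof.
move=> Pm; rewrite -(expect_average Pm i) -[RHS](expect_cst Pm).
by apply: eq_expect => x; apply: eq_bigr => t _; rewrite update_same.
Qed.

(** Exchanging the two points on [V] turns the spliced point into one of the pair; the weights
    survive because [P] and [Q] agree off [V]. *)
Lemma expect_mix g : is_marginals Q -> (forall i t, i \notin V -> Q i t = P i t) ->
  expect Q (fun y => expect P (fun x => g (mix x y))) = expect P g.
Proof.
move=> Qm QP; pose swap (u : {ffun I -> T} * {ffun I -> T}) := (mix u.2 u.1, mix u.1 u.2).
have swapK : involutive swap.
  by case=> y x; congr (_, _); apply/ffunP => k; rewrite !ffunE; case: (k \in V).
have swapW y x : weight Q (mix y x) * weight P (mix x y) = weight Q y * weight P x.
  rewrite /weight -!big_split; apply: eq_bigr => i _; rewrite /= !ffunE.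
  by case: ifPn => // iV; rewrite !QP // mulrC.
have -> : expect Q (fun y => expect P (fun x => g (mix x y))) =
    \sum_u weight Q u.1 * weight P u.2 * g (mix u.2 u.1).
  rewrite -(pair_big xpredT xpredT (fun y x => weight Q y * weight P x * g (mix x y))) /=.
  by apply: eq_bigr => y _; rewrite mulr_sumr; apply: eq_bigr => x _; rewrite mulrA.
rewrite (reindex_inj (inv_inj swapK)) /=.
transitivity (\sum_y weight Q y * expect P g); last by rewrite -mulr_suml sum_weight ?mul1r.
rewrite -(pair_big xpredT xpredT (fun y x => weight Q (mix x y) * weight P (mix y x) *
  g (mix (mix y x) (mix x y)))) /=.
rewrite exchange_big /=; apply: eq_bigr => y _; rewrite /expect mulr_sumr.
apply: eq_bigr => x _; rewrite swapW mulrA; congr (_ * g _).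
by apply/ffunP => k; rewrite !ffunE; case: (k \in V).
Qed.

End Mixing.

(** * Coalitions sampled from the very biased coordinates *)

Section SampledCoalitions.
Variables (n m : nat) (V : {set 'I_n}) (z : 'I_n -> bool).
Implicit Types (x y : cube n) (f : cube n -> bool) (S : {set 'I_n}) (c : bool)
  (X : {ffun 'I_m -> cube n}) (i j : 'I_m) (A B : {set 'I_m}).

Definition minority x : {set 'I_n} := [set k in V | x k != z k].

(** The index set is a parameter because both the full family of samples and the family without one
    sample are needed. *)
Definition others A X i : {set 'I_n} := \bigcup_(l in A :\ i) minority (X l).

Definition constant_on f c S x : bool := [forall w in coalition_box S x, f w == c].

Lemma constant_onS f c S S' x : S \subset S' -> constant_on f c S' x -> constant_on f c S x.
Proof.
move=> SS' /forall_inP h; apply/forall_inP => w /coalition_boxP xw; apply: h.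
by apply/coalition_boxP => j jS'; apply: xw; apply: contra jS'; apply: (subsetP SS').
Qed.

Lemma othersS A B X i : A \subset B -> others A X i \subset others B X i.
Proof.
move=> AB; apply/bigcupsP => l lA; apply: (bigcup_sup l) => //.
exact: (subsetP (setSD _ AB)).
Qed.

(* The point that takes the minority value exactly where one of the two
   samples does lies in both boxes. *)
Lemma constant_on_agree f A X y i j c c' : i \in A -> j \in A ->
    constant_on f c (others A X i) (mix V (X i) y) ->
    constant_on f c' (others A X j) (mix V (X j) y) ->
  c = c'.
Proof.
move=> iA jA.
have [<- /forall_inP h /forall_inP h'|ij /forall_inP h /forall_inP h'] := eqVneq i j.
  have xx := coalition_box_refl (others A X i) (mix V (X i) y).
  by rewrite -(eqP (h _ xx)) -(eqP (h' _ xx)).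
pose w : cube n := [ffun k => if k \in V then
  (if (k \in minority (X i)) || (k \in minority (X j)) then ~~ z k else z k) else y k].
have in_box a b : b \in A -> b != a ->
    (forall k, (k \in minority (X i)) || (k \in minority (X j)) =
               (k \in minority (X a)) || (k \in minority (X b))) ->
    w \in coalition_box (others A X a) (mix V (X a) y).
  move=> bA ba ab; apply/coalition_boxP => k kS; rewrite !ffunE.
  case: ifP => // kV; rewrite ab.
  have /negbTE -> : k \notin minority (X b).
    by apply: contra kS => kb; apply/bigcupP; exists b; rewrite // in_setD1 ba.
  rewrite orbF inE kV /=.
  by case: (X a k) (z k) => -[].
have wi : w \in coalition_box (others A X i) (mix V (X i) y).
  by apply: (in_box i j) => //; rewrite eq_sym.
have wj : w \in coalition_box (others A X j) (mix V (X j) y).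
  by apply: (in_box j i) => // k; rewrite orbC.
by rewrite -(eqP (h _ wi)) -(eqP (h' _ wj)).
Qed.

(* A value that no sample other than [i] forces against the remaining ones. *)
Definition free_value f y X i : bool :=
  ~~ [exists j in [set~ i], constant_on f true (others [set~ i] X j) (mix V (X j) y)].

(** If another sample has a box constantly [true], agreement excludes boxes constantly [false]; if
    none has, [true] itself is free. *)
Lemma free_valueP f y X i j : j != i ->
  ~~ constant_on f (free_value f y X i) (others [set~ i] X j) (mix V (X j) y).
Proof.
move=> ji; apply/negP; rewrite /free_value.
case: existsP => [[l /andP[li hl]] hj|none hj].
  by have := constant_on_agree li _ hl hj; rewrite !inE => /(_ ji).
by apply: none; exists j; rewrite !inE ji.
Qed.

(** Two such samples would share their colour. Dropping the first from the family shrinks the box of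
    the second, which then shows the free value of the first. *)
Lemma sum_constant_on_le1 f y X :
  (\sum_i constant_on f (free_value f y X i) (others setT X i) (mix V (X i) y) <= 1)%N.
Proof.
have [[i hi]|none] := altP (@existsP _
    (fun i => constant_on f (free_value f y X i) (others setT X i) (mix V (X i) y))).
  rewrite (bigD1 i) //= hi big1 // => j ji; apply/eqP; rewrite eqb0; apply/negP => hj.
  have e := constant_on_agree (in_setT i) (in_setT j) hi hj.
  have := free_valueP f y X ji; rewrite e => /negP; apply.
  by apply: constant_onS hj; apply/othersS/subsetT.
rewrite big1 // => i _; apply/eqP; rewrite eqb0.
by apply: contra none => hi; apply/existsP; exists i.
Qed.

(** This and the next two lemmas say that resampling [X i] disturbs neither the coalition nor the
    colour attached to [i], so both stay fixed while [X i] is averaged. *)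
Lemma others_update A X i x : others A (update X i x) i = others A X i.
Proof.
apply: eq_bigr => l; rewrite in_setD1 => /andP[li _].
by rewrite ffunE (negbTE li).
Qed.

Lemma others_updateC X i j x : others [set~ i] (update X i x) j = others [set~ i] X j.
Proof.
apply: eq_bigr => l; rewrite !inE => /andP[_ li].
by rewrite ffunE (negbTE li).
Qed.

Lemma free_value_update f y X i x : free_value f y (update X i x) i = free_value f y X i.
Proof.
congr (~~ _); apply: eq_existsb => j; rewrite !inE.
by have [//|ji] := eqVneq j i; rewrite others_updateC ffunE (negbTE ji).
Qed.

Variables (R : realFieldType) (P Q : 'I_n -> bool -> R).
Hypotheses (Pm : is_marginals P) (Qm : is_marginals Q).

Definition constant_prob f c S y : R :=
  expect P (fun x => (constant_on f c S (mix V x y))%:R).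

(** A box constantly [c] blocks exactly the value [~~ c], so this is the failure probability of the
    better target value. *)
Definition unforceable f S y : R :=
  Num.min (constant_prob f true S y) (constant_prob f false S y).

(** Independent samples form another product space, with whole points of the cube as letters. *)
Definition sample_marginals (i : 'I_m) (x : cube n) : R := weight P x.

Lemma sample_marginalsP : is_marginals sample_marginals.
Proof.
split=> [i x|i]; first exact: weight_ge0.
exact: sum_weight.
Qed.

Lemma constant_prob_ge0 f c S y : 0 <= constant_prob f c S y.
Proof. by apply: (expect_ge0 Pm) => x; apply: ler0n. Qed.

Lemma constant_prob_le1 f c S y : constant_prob f c S y <= 1.
Proof.
rewrite -[leRHS](expect_cst Pm); apply: (ler_expect Pm) => x.
by rewrite lern1 leq_b1.
Qed.

Lemma unforceable_ge0 f S y : 0 <= unforceable f S y.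
Proof. by rewrite le_min !constant_prob_ge0. Qed.

Lemma expect_unforceable f y :
  expect sample_marginals (fun X => \sum_i unforceable f (others setT X i) y) <= 1.
Proof.
pose forced X i := constant_on f (free_value f y X i) (others setT X i) (mix V (X i) y).
apply: (@le_trans _ _ (expect sample_marginals (fun X => \sum_i (forced X i)%:R))).
  rewrite !expect_sum; apply: ler_sum => i _.
  rewrite -[leRHS](expect_average sample_marginalsP i).
  apply: (ler_expect sample_marginalsP) => X.
  rewrite [leRHS](_ : _ = constant_prob f (free_value f y X i) (others setT X i) y).
    by rewrite /unforceable; case: free_value; rewrite ge_min lexx ?orbT.
  apply: eq_bigr => x _.
  by rewrite /forced free_value_update others_update update_same.
rewrite -[leRHS](expect_cst sample_marginalsP).
apply: (ler_expect sample_marginalsP) => X; rewrite -natr_sum lern1.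
exact: sum_constant_on_le1.
Qed.

Lemma expect_card_others (B : R) : 0 <= B ->
    expect P (fun x => #|minority x|%:R) <= B ->
  expect sample_marginals (fun X => \sum_i #|others setT X i|%:R) <= m%:R ^+ 2 * B.
Proof.
move=> B0 le_B.
apply: (@le_trans _ _ (expect sample_marginals
  (fun X => \sum_(i < m) \sum_l #|minority (X l)|%:R))).
  apply: (ler_expect sample_marginalsP) => X; apply: ler_sum => i _.
  rewrite -natr_sum ler_nat /others.
  apply: leq_trans (_ : \sum_(l in setT :\ i) #|minority (X l)| <= _)%N.
    by elim/big_rec2: _ => [|l k S _ le]; rewrite ?cards0 // cardsU
      (leq_trans (leq_subr _ _)) ?leq_add2l.
  by rewrite big_mkcond leq_sum // => l _; case: ifP.
rewrite expect_sum sumr_const card_ord expect_sum -[leLHS]mulr_natl expr2 -mulrA.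
apply: ler_wpM2l => //.
rewrite (eq_bigr (fun=> expect P (fun x => #|minority x|%:R))); last first.
  by move=> l _; rewrite (expect_coordinate l (fun x => #|minority x|%:R) sample_marginalsP).
by rewrite sumr_const card_ord -[leLHS]mulr_natl ler_wpM2l.
Qed.

Lemma exists_forcing_coalition f (B : R) : (0 < m)%N -> 0 < B ->
    expect P (fun x => #|minority x|%:R) <= B ->
  exists S, expect Q (unforceable f S) <= 2 / m%:R /\ #|S|%:R <= 2 * m%:R * B.
Proof.
move=> m0 B0 le_B; have mR : 0 < m%:R :> R by rewrite ltr0n.
have mB : 0 < m%:R ^+ 2 * B by rewrite mulr_gt0 ?exprn_gt0.
pose phi S := expect Q (unforceable f S).
have phi0 S : 0 <= phi S by apply: (expect_ge0 Qm) => y; apply: unforceable_ge0.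
have E1 : expect sample_marginals (fun X => \sum_i phi (others setT X i)) <= 1.
  rewrite (_ : expect _ _ = expect Q (fun y =>
    expect sample_marginals (fun X => \sum_i unforceable f (others setT X i) y))).
    rewrite -[leRHS](expect_cst Qm); apply: (ler_expect Qm) => y.
    exact: expect_unforceable.
  rewrite -expect_exchange; apply: eq_expect => X.
  by rewrite expect_sum.
have E2 := expect_card_others (ltW B0) le_B.
(* Each cost is scaled to have expected sum at most 1, so one sample, and then one index, controls
   both. *)
have /(expect_le_exists sample_marginalsP)[X hX] : expect sample_marginals
    (fun X => \sum_i (phi (others setT X i) + (m%:R ^+ 2 * B)^-1 * #|others setT X i|%:R)) <= 2.
  rewrite (@eq_expect _ _ _ _ _ (fun X => \sum_i phi (others setT X i) +
     (m%:R ^+ 2 * B)^-1 * \sum_i #|others setT X i|%:R)); last first.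
    by move=> X; rewrite big_split mulr_sumr.
  rewrite expectD expectZ (_ : 2 = 1 + 1) //; apply: lerD => //.
  by rewrite mulrC ler_pdivrMr // mul1r.
have [i hi] : exists i, phi (others setT X i) +
    (m%:R ^+ 2 * B)^-1 * #|others setT X i|%:R <= 2 / m%:R.
  apply/existsP; apply: contraLR hX; rewrite negb_exists => /forallP big.
  have twoE : 2 = \sum_(i < m) 2 / m%:R :> R.
    by rewrite sumr_const card_ord -[_ *+ m]mulr_natr divfK // lt0r_neq0.
  rewrite -ltNge {1}twoE; apply: ltr_sum => [|i _]; last by rewrite ltNge.
  by apply/hasP; exists (Ordinal m0); rewrite ?mem_index_enum.
exists (others setT X i); split.
  apply: le_trans hi; rewrite lerDl mulr_ge0 ?invr_ge0 //; exact: ltW.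
have : (m%:R ^+ 2 * B)^-1 * #|others setT X i|%:R <= 2 / m%:R.
  by apply: le_trans hi; rewrite lerDr.
rewrite mulrC ler_pdivrMr //.
by rewrite (_ : 2 / m%:R * _ = 2 * m%:R * B) //; field; rewrite lt0r_neq0.
Qed.

End SampledCoalitions.

(** * Product measures as weights of marginals *)

Section ProductProbability.
Variables (R : realType) (n : nat) (mu : cube n -> R).
Hypothesis mu_prod : product_probability mu.

Definition marginal (i : 'I_n) (b : bool) : R :=
  Pr mu [set x : cube n | x i \in [set b]].

Lemma product_weightE x : mu x = weight marginal x.
Proof.
have := mu_prod.2 (fun i => [set x i]).
rewrite /Pr (_ : [set _ | _] = [set x]); first by rewrite big_set1.
apply/setP => y; rewrite !inE; apply/forallP/eqP => [h|-> i]; last by rewrite inE.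
by apply/ffunP => i; have := h i; rewrite inE => /eqP.
Qed.

Lemma marginalP : is_marginals marginal.
Proof.
split=> [i b|i]; first by apply: sumr_ge0 => x _; apply: mu_prod.1.1.
rewrite big_bool -mu_prod.1.2 /= /marginal /Pr.
rewrite [RHS](bigID (fun x : cube n => x i)) /=.
by congr (_ + _); apply: eq_bigl => x; rewrite !inE; case: (x i).
Qed.

Lemma influence_expect f S b :
  influence mu f S b = expect marginal (fun x => (b \in f @: coalition_box S x)%:R).
Proof.
rewrite /influence /Pr big_mkcond; apply: eq_bigr => x _.
by rewrite -product_weightE inE; case: ifP; rewrite ?mulr1 ?mulr0.
Qed.

End ProductProbability.

Lemma mem_image_box n (f : cube n -> bool) b S x :
  (b \in f @: coalition_box S x) = ~~ constant_on f (~~ b) S x.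
Proof.
rewrite negb_forall_in; apply/imsetP/exists_inP => [[w wx ->]|[w wx fw]]; exists w => //.
  by case: (f w).
by case: (f w) (b) fw => -[].
Qed.

(** * Combining the two coalitions *)

Section BiasingCoalition.
Variables (R : realType) (n : nat) (P : 'I_n -> bool -> R) (f : cube n -> bool).
Variables (delta eta : R) (m : nat).
Hypotheses (Pm : is_marginals P) (n_gt1 : (1 < n)%N) (m_gt0 : (0 < m)%N).
Hypotheses (delta0 : 0 < delta) (delta2 : delta <= 1 / 2).
Hypotheses (eta0 : 0 < eta) (eta1 : eta < 1) (m_large : 2 / m%:R <= eta ^+ 2).

Let V : {set 'I_n} := [set k | (P k true < delta) || (P k false < delta)].
(** The likely value on [V], where [false] is rare whenever [true] is not. *)
Let z (k : 'I_n) : bool := ~~ (P k true < delta).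
(** Fair coins on [V] make all marginals at least [delta], so boosting works on the whole cube;
    [mix V x y] ignores [y] on [V] anyway. *)
Let Q (k : 'I_n) (t : bool) : R := if k \in V then 1 / 2 else P k t.

Let Qm : is_marginals Q.
Proof.
split=> [i t|i]; rewrite /Q; case: (i \in V).
- lra.
- exact: Pm.1.
- rewrite big_bool /=; lra.
- exact: Pm.2.
Qed.

Let Q_ge i t : delta <= Q i t.
Proof.
rewrite /Q; case: ifPn => //; rewrite inE negb_or -!leNgt => /andP[].
by case: t.
Qed.

Let QP i t : i \notin V -> Q i t = P i t.
Proof. by rewrite /Q => /negbTE ->. Qed.

Let expect_card_minority : expect P (fun x => #|minority V z x|%:R) <= delta * n%:R.
Proof.
rewrite (@eq_expect _ _ _ _ _ (fun x : cube n =>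
  \sum_k ((k \in V) && (x k != z k))%:R)); last first.
  move=> x; rewrite -natr_sum -sum1_card big_mkcond /=; congr _%:R.
  by apply: eq_bigr => k _; rewrite inE; case: ifP.
rewrite expect_sum mulr_natr -[n in X in _ <= X]card_ord -sumr_const.
apply: ler_sum => k _.
rewrite (expect_coordinate k (fun t => ((k \in V) && (t != z k))%:R) Pm) big_bool.
rewrite inE /z; have [lt|ge] /= := ltP (P k true) delta; first by rewrite mulr1 mulr0 addr0 ltW.
rewrite andbF mulr0 add0r andbT; have [lt|_] := ltP (P k false) delta; first by rewrite mulr1 ltW.
by rewrite mulr0 ltW.
Qed.

Lemma expect_image S b : expect P (fun x => (b \in f @: coalition_box S x)%:R) =
  expect Q (fun y => expect P (fun x => (b \in f @: coalition_box S (mix V x y))%:R)).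
Proof. by rewrite (expect_mix (fun x => (b \in f @: coalition_box S x)%:R) Qm QP). Qed.

(** First [T] moves [y] to [y'], then [S] acts on the spliced point. *)
Lemma expect_image_ge (S T : {set 'I_n}) b (y y' : cube n) : y' \in coalition_box T y ->
  1 - constant_prob V P f (~~ b) S y' <=
  expect P (fun x => (b \in f @: coalition_box (S :|: T) (mix V x y))%:R).
Proof.
move=> /coalition_boxP yy'.
rewrite /constant_prob -[X in X - _](expect_cst Pm) -expectB.
apply: (ler_expect Pm) => x; rewrite mem_image_box.
have : ~~ constant_on f (~~ b) S (mix V x y') -> ~~ constant_on f (~~ b) (S :|: T) (mix V x y).
  apply: contra => /forall_inP h; apply/forall_inP => w /coalition_boxP xw; apply: h.
  apply/coalition_boxP => j; rewrite inE negb_or => /andP[jS jT].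
  by rewrite xw // !ffunE yy'.
by case: constant_on => /= [_|->]; rewrite ?subrr ?subr0.
Qed.

Lemma biasing_coalition : exists (S : {set 'I_n}) (b : bool),
  1 - 3 * eta <= expect P (fun x => (b \in f @: coalition_box S x)%:R) /\
  #|S|%:R <= 2 * m%:R * (delta * n%:R) +
    (4 * n%:R * (34 * (1 - ln delta)) / (eta * (1 - eta) * ln n%:R) + 1).
Proof.
have [e0 e1 d2] := And3 eta0 eta1 delta2.
have lnd : ln delta <= 0 by apply: ln_le0; lra.
have n0 : 0 < n%:R :> R by rewrite ltr0n; apply: leq_trans n_gt1.
have [S [S_forces S_card]] :=
  exists_forcing_coalition Pm Qm f m_gt0 (mulr_gt0 delta0 n0) expect_card_minority.
pose h (y : cube n) := constant_prob V P f false S y <= eta.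
have L0 : 0 < ln n%:R :> R by apply: ln_gt0; rewrite ltr1n.
have [h_ge|h_lt] := lerP eta (prob Q h).
  have [T [T_boost T_card]] := boosting_coalition Qm delta0 Q_ge n_gt1 eta0 eta1 h_ge.
  exists (S :|: T), true; split; last first.
    apply: le_trans (lerD S_card T_card); rewrite -natrD ler_nat.
    by rewrite cardsU leq_subr.
  rewrite expect_image; apply: (@le_trans _ _ ((1 - eta) * prob Q (boost T h))).
    have : (1 - eta) * (1 - eta) <= (1 - eta) * prob Q (boost T h).
      by apply: ler_wpM2l => //; lra.
    have := sqr_ge0 eta; lra.
  rewrite -expectZ; apply: (ler_expect Qm) => y.
  have [/existsP[y' /andP[yy' hy']]|_] := boolP (boost T h y).
    by rewrite mulr1; apply: le_trans (expect_image_ge S true yy'); rewrite lerD2l lerN2.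
  by rewrite mulr0; apply: (expect_ge0 Pm) => x.
exists S, false; split; last first.
  apply: le_trans S_card _; rewrite lerDl addr_ge0 // divr_ge0 //.
    by apply: mulr_ge0; [exact/ltW/mulr_gt0|lra].
  by apply: mulr_ge0; [apply: mulr_ge0; lra|exact: ltW].
rewrite expect_image.
apply: (@le_trans _ _ (expect Q (fun y => 1 - constant_prob V P f true S y))); last first.
  apply: (ler_expect Qm) => y.
  by have := expect_image_ge S false (coalition_box_refl set0 y); rewrite setU0.
rewrite expectB (expect_cst Qm) lerD2l lerN2.
(* Three losses of [eta]: the event [h], the residual failure when [false] can be forced, and, by
   Markov, the points where neither value can. *)
apply: (@le_trans _ _ (expect Q (fun y => (h y)%:R + (eta + eta^-1 * unforceable V P f S y)))).
  apply: (ler_expect Qm) => y; rewrite /h.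
  have u0 := unforceable_ge0 V Pm f S y.
  have eu0 : 0 <= eta^-1 * unforceable V P f S y by rewrite mulr_ge0 // invr_ge0 ltW.
  have c1 := constant_prob_le1 V Pm f true S y.
  have [cf|cf] := lerP (constant_prob V P f false S y) eta; rewrite /= ?mulr1n ?mulr0n ?add0r.
    lra.
  have [ct|ct] := lerP (constant_prob V P f true S y) eta; first by lra.
  suff : 1 <= eta^-1 * unforceable V P f S y by lra.
  by rewrite mulrC ler_pdivlMr // mul1r le_min !ltW.
rewrite !expectD expectZ (expect_cst Qm) -/(prob Q h).
have : eta^-1 * expect Q (unforceable V P f S) <= eta.
  by rewrite mulrC ler_pdivrMr // -expr2; apply: le_trans S_forces _.
lra.
Qed.

End BiasingCoalition.

(** * Choice of the parameters *)

Theorem theorem1 (R : realType) (eps : R) (heps0 : 0 < eps) (heps1 : eps < 1) :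
  exists (C : R) (N : nat), 0 < C /\
    forall (n : nat) (mu : cube n -> R) (f : cube n -> bool),
      (N <= n)%N -> product_probability mu ->
      exists (S : {set 'I_n}) (b : bool),
        #|S|%:R <= C * (n%:R * ln (ln n%:R) / ln n%:R) /\
        1 - eps <= influence mu f S b.
Proof.
pose eta := eps / 4.
have eta0 : 0 < eta by rewrite /eta; lra.
have eta1 : eta < 1 by rewrite /eta; lra.
pose m := (Num.truncn (2 / eta ^+ 2)).+1.
have m_large : 2 / m%:R <= eta ^+ 2.
  have e2 : 0 < eta ^+ 2 by apply: exprn_gt0.
  by rewrite ler_pdivrMr ?ltr0n // mulrC -ler_pdivrMr // ltW // truncnS_gt.
have ee : 0 < eta * (1 - eta) by apply: mulr_gt0; lra.
(* Here 272 is 2 * 4 * 34, the extra 2 coming from [1 + ln L <= 2 * ln L]. *)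
pose D := 272 / (eta * (1 - eta)).
have D0 : 0 < D by rewrite divr_gt0.
have mR : 0 < m%:R :> R by rewrite ltr0n.
(* The summands of [C] pay for sampling, boosting and rounding; [N] ensures [ln (ln n%:R) > 1]. *)
exists (2 * m%:R + D + 1), (Num.truncn (expR (expR 1) : R)).+1.
split; first lra.
move=> n mu f Nn mu_prod.
have n_large : expR (expR 1) < n%:R :> R.
  by apply: lt_le_trans (truncnS_gt _) _; rewrite ler_nat.
have n0 : 0 < n%:R :> R by apply: lt_trans n_large; apply: expR_gt0.
set L : R := ln n%:R.
have L_large : expR 1 < L by rewrite -ltr_expR lnK ?posrE.
have L2 : 2 <= L by have := expR_ge1Dx (1 : R); lra.
have L0 : 0 < L by lra.
have LL1 : 1 < ln L by rewrite -ltr_expR lnK ?posrE.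
have nL : L < n%:R by apply: ln_sublinear.
have n_gt1 : (1 < n)%N by rewrite -(ltr_nat R); lra.
have d0 : 0 < L^-1 by rewrite invr_gt0.
have d2 : L^-1 <= 1 / 2 by rewrite div1r lef_pV2 ?posrE.
have [S [b [Sb S_card]]] :=
  biasing_coalition f (marginalP mu_prod) n_gt1 (isT : (0 < m)%N) d0 d2 eta0 eta1 m_large.
exists S, b; split; last first.
  by rewrite (influence_expect mu_prod); apply: le_trans Sb; rewrite /eta; lra.
apply: le_trans S_card _; rewrite lnV ?posrE // opprK -/L.
set x := n%:R / L.
have x1 : 1 <= x by rewrite ler_pdivlMr // mul1r ltW.
have -> : n%:R * ln L / L = x * ln L by rewrite /x; ring.
have -> : L^-1 * n%:R = x by rewrite mulrC.
have -> : 4 * n%:R * (34 * (1 + ln L)) / (eta * (1 - eta) * L) = D / 2 * (x * (1 + ln L)).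
  by rewrite /D /x; field; rewrite !lt0r_neq0 //; lra.
have xL : x <= x * ln L by rewrite ler_peMr //; lra.
have : 2 * m%:R * x <= 2 * m%:R * (x * ln L) by rewrite ler_pM2l // mulr_gt0.
have : D / 2 * (x * (1 + ln L)) <= D / 2 * (2 * (x * ln L)).
  by rewrite ler_pM2l ?divr_gt0 //; lra.
lra.
Qed.
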